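(* Let $\mathbb{F}$ be an algebraically closed field and let $m,n$ be integers with $2<m\le n$. Let $R=\mathbb{F}[x_{i,j},y_{i,j}:1\le i\le m,\ 1\le j\le n]$ with all variables of degree $1$, and let $\mathcal{I}_0\subset R$ be the ideal of the principal component $Z_0$ of the first-order jet scheme $\mathcal{Z}_{2,2}^{m,n}$. Then the Hilbert series of $R/\mathcal{I}_0$ is $$\left(\frac{\sum_{e=0}^{m-1}\binom{m-1}{e}\binom{n-1}{e}z^e}{(1-z)^{m+n-1}}\right)^2 .$$
   Context: $\mathcal{Z}_2^{m,n}\subset\mathbb{A}^{mn}_{\mathbb{F}}$ is the variety of $m\times n$ matrices of rank $\le 1$. Let $X=(x_{i,j})$ and $Y=(y_{i,j})$. The first-order jet scheme $\mathcal{Z}_{2,2}^{m,n}\subset\mathbb{A}^{2mn}$ is defined by the ideal of $R$ generated by, for every $2\times 2$ minor $f$ of a generic $m\times n$ matrix, the coefficients of $t^0$ and $t^1$ in $f(X+tY)$ modulo $t^2$. Its principal component $Z_0$ is the closure of the set of jets lying over the smooth locus of $\mathcal{Z}_2^{m,n}$ (the nonzero rank-one matrices); $\mathcal{I}_0$ is the homogeneous prime vanishing ideal of $Z_0$ in $R$. The Hilbert series is $\sum_{d\ge0}\dim_{\mathbb{F}}(R/\mathcal{I}_0)_d\,z^d$. *)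

(* Defs.v *)
From HB Require Import structures.
From mathcomp Require Import all_boot all_order all_algebra.
From mathcomp Require Import mpoly.

Set Implicit Arguments.
Unset Strict Implicit.
Unset Printing Implicit Defensive.

Import GRing.Theory.
Local Open Scope ring_scope.

Section AffineGeometry.
Variables (F : fieldType) (N : nat).
Implicit Types (I : {mpoly F[N]} -> Prop) (S : 'rV[F]_N -> Prop).

Definition is_ideal I : Prop :=
  [/\ I 0, (forall p q, I p -> I q -> I (p + q))
    & (forall r p, I p -> I (r * p))].

Definition ideal_gen (G : {mpoly F[N]} -> Prop) (p : {mpoly F[N]}) : Prop :=
  forall I, is_ideal I -> (forall g, G g -> I g) -> I p.

Definition zero_locus I (v : 'rV[F]_N) : Prop :=
  forall p, I p -> p.@[v ord0] = 0.

Definition vanishing_ideal S (p : {mpoly F[N]}) : Prop :=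
  forall v, S v -> p.@[v ord0] = 0.

Definition zariski_closure S (v : 'rV[F]_N) : Prop :=
  forall I, is_ideal I -> (forall w, S w -> zero_locus I w) -> zero_locus I v.

(* The F-vector space (R/I)_d, i.e. the image of R_d in R/I, has dimension k:
   the classes modulo I of some k forms of degree d are a basis of it. *)
Definition quot_dim I (d k : nat) : Prop :=
  exists b : 'I_k -> {mpoly F[N]},
    [/\ (forall i, b i \is d.-homog),
        (forall c : 'I_k -> F,
           I (\sum_(i < k) c i *: b i) -> forall i, c i = 0)
      & (forall p, p \is d.-homog ->
           exists c : 'I_k -> F, I (p - \sum_(i < k) c i *: b i))].

Lemma is_idealZ I (c : F) p : is_ideal I -> I p -> I (c *: p).
Proof. by case=> _ _ IM Ip; rewrite -mul_mpolyC; apply: IM. Qed.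

Lemma is_ideal_sum I k (f : 'I_k -> {mpoly F[N]}) :
  is_ideal I -> (forall i, I (f i)) -> I (\sum_i f i).
Proof. by case=> I0 ID _ If; apply: (big_ind I). Qed.

Lemma quot_dim_leq I d k l : is_ideal I ->
  quot_dim I d k -> quot_dim I d l -> (l <= k)%N.
Proof.
move=> idI [b [_ _ genb]] [b' [hb' freeb' _]]; rewrite leqNgt; apply/negP=> ltkl.
have: forall i : 'I_l, exists c : {ffun 'I_k -> F},
    I (b' i - \sum_(j < k) c j *: b j).
  move=> i; have [c Ic] := genb _ (hb' i); exists (finfun c).
  by under eq_bigr => j _ do rewrite ffunE.
move/fin_all_exists=> [C IC].
pose M : 'M[F]_(l, k) := \matrix_(i, j) C i j.
have : kermx M != 0.
  by rewrite -mxrank_eq0 mxrank_ker -lt0n subn_gt0 (leq_ltn_trans (rank_leq_col M)).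
case/rowV0Pn=> u /sub_kermxP uM0 /negP; apply; apply/eqP/rowP=> i.
rewrite [RHS]mxE; apply: (freeb' (fun i => u ord0 i)).
have -> : \sum_(i < l) u ord0 i *: b' i =
          \sum_(i < l) u ord0 i *: (b' i - \sum_(j < k) C i j *: b j).
  under [RHS]eq_bigr => a _ do rewrite scalerBr.
  rewrite sumrB [X in _ - X](_ : _ = 0) ?subr0 //.
  under eq_bigr => a _ do rewrite scaler_sumr.
  rewrite exchange_big big1 // => j _ /=.
  under eq_bigr => a _ do rewrite scalerA.
  rewrite -scaler_suml; move/rowP/(_ j): uM0; rewrite !mxE.
  under eq_bigr => a _ do rewrite mxE.
  by move=> ->; rewrite scale0r.
by apply: is_ideal_sum => // a; apply: is_idealZ.
Qed.

Lemma quot_dim_uniq I d k l : is_ideal I ->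
  quot_dim I d k -> quot_dim I d l -> k = l.
Proof.
by move=> idI Hk Hl; apply/eqP; rewrite eqn_leq !(@quot_dim_leq I d).
Qed.

Lemma vanishing_ideal_is_ideal S : is_ideal (vanishing_ideal S).
Proof.
split=> [v _|p q Ip Iq v Sv|r p Ip v Sv]; first by rewrite meval0.
  by rewrite mevalD Ip // Iq // addr0.
by rewrite mevalM Ip // mulr0.
Qed.

End AffineGeometry.

(* Formal power series over rat, given by their coefficients. *)
Definition fps := nat -> rat.

Definition fps_poly (p : {poly rat}) : fps := fun d => p`_d.

Definition fps_mul (a b : fps) : fps :=
  fun d => \sum_(i < d.+1) a i * b (d - i)%N.

(* The first d + 1 coefficients of 1 / a, for a 0 != 0. *)
Fixpoint fps_inv_seq (a : fps) (d : nat) : seq rat :=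
  if d is d'.+1 then
    let s := fps_inv_seq a d' in
    rcons s (- (a 0%N)^-1 * \sum_(i < d) a i.+1 * s`_(d' - i))
  else [:: (a 0%N)^-1].

Definition fps_inv (a : fps) : fps := fun d => (fps_inv_seq a d)`_d.

Definition fps_div (a b : fps) : fps := fps_mul a (fps_inv b).

Lemma size_fps_inv_seq a d : size (fps_inv_seq a d) = d.+1.
Proof. by elim: d => //= d IHd; rewrite size_rcons IHd. Qed.

Lemma nth_fps_inv_seq a d i :
  (i <= d)%N -> (fps_inv_seq a d)`_i = fps_inv a i.
Proof.
elim: d => [|d IHd]; first by rewrite leqn0 => /eqP->.
rewrite leq_eqVlt => /predU1P[-> //|ltid].
by rewrite /= nth_rcons size_fps_inv_seq ltid IHd.
Qed.

Lemma fps_mulV (a : fps) : a 0%N != 0 ->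
  fps_mul a (fps_inv a) =1 fps_poly 1.
Proof.
move=> a0 d; rewrite /fps_mul /fps_poly coef1 big_ord_recl subn0.
case: d => [|d]; first by rewrite big_ord0 addr0 /fps_inv /= divff.
have -> : fps_inv a d.+1 =
    - (a 0%N)^-1 * \sum_(i < d.+1) a i.+1 * fps_inv a (d - i)%N.
  rewrite /fps_inv /= nth_rcons size_fps_inv_seq ltnn eqxx.
  by congr (_ * _); apply: eq_bigr => i _; rewrite nth_fps_inv_seq ?leq_subr.
rewrite mulrA mulrN divff // mulN1r.
by apply/eqP; rewrite addrC subr_eq0.
Qed.

Definition is_hilbert_series (F : fieldType) (N : nat)
    (I : {mpoly F[N]} -> Prop) (H : fps) : Prop :=
  forall d : nat, exists2 k : nat, quot_dim I d k & H d = k%:R.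

Section DeterminantalJets.
Variables (F : fieldType) (m n : nat).

(* Affine 2mn-space: a point v stands for the pair of matrices
   (vec_mx (lsubmx v), vec_mx (rsubmx v)), i.e. the jet X + tY. *)
Local Notation N := (m * n + m * n)%N.
Local Notation R := {mpoly F[N]}.

Definition genX : 'M[R]_(m, n) :=
  \matrix_(i, j) 'X_(lshift (m * n) (mxvec_index i j)).

Definition genY : 'M[R]_(m, n) :=
  \matrix_(i, j) 'X_(rshift (m * n) (mxvec_index i j)).

Definition gen_jet : 'M[{poly R}]_(m, n) :=
  map_mx polyC genX + 'X *: map_mx polyC genY.

Definition minor2 (A : 'M[{poly R}]_(m, n))
    (i1 i2 : 'I_m) (j1 j2 : 'I_n) : {poly R} :=
  \det (mxsub (tnth [tuple i1; i2]) (tnth [tuple j1; j2]) A).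

Definition jet_generator (p : R) : Prop :=
  exists (i1 i2 : 'I_m) (j1 j2 : 'I_n) (k : nat),
    [/\ (i1 < i2)%N, (j1 < j2)%N, (k < 2)%N
      & p = (minor2 gen_jet i1 i2 j1 j2)`_k].

Definition jet_ideal : R -> Prop := ideal_gen jet_generator.

Definition jets : 'rV[F]_N -> Prop := zero_locus jet_ideal.

Definition smooth_rank_le1 (A : 'M[F]_(m, n)) : Prop :=
  (\rank A <= 1)%N /\ A != 0.

Definition jets_over_smooth (v : 'rV[F]_N) : Prop :=
  jets v /\ smooth_rank_le1 (vec_mx (lsubmx v)).

Definition principal_component : 'rV[F]_N -> Prop :=
  zariski_closure jets_over_smooth.

Definition principal_ideal : R -> Prop :=
  vanishing_ideal principal_component.

End DeterminantalJets.

(* Main.v *)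
(* The principal component is the closure of the tangent bundle of the rank-one
   matrices: its points are (u v^T, s v^T - u q^T), so R / I_0 is the algebra A
   generated by the entries of these two matrices in F[u, v, s, q].

   Upper bound.  For e != 0 the pair (u v^T, s v^T - u q^T - e s q^T) is, up to
   linear changes of coordinates in the source and in the target, the pair
   (u v^T, s q^T) parametrizing the product of two rank-one loci, whose
   coordinate ring has the monomials with deg u = deg v and deg s = deg q as a
   basis.  Ranks can only drop when e specializes to 0, so dim A_d is at most the
   number of these balanced monomials of degree d.

   Lower bound.  Writing the coordinates as the columns (u_i, s_i) and (v_j, q_j)
   of a 2 x (m + n) matrix, A contains every product of entries of the first row
   and of 2 x 2 minors that has degree d in the columns of (u, s) and degree d in
   those of (v, q).  The leading monomials of such products are the ballot
   monomials, and the bracketing rule for crystals of sl_2 injects the balanced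
   monomials (the words of weight 0) into the ballot ones (the highest weight
   words). *)

From HB Require Import structures.
Require Import Defs.
From mathcomp Require Import all_boot all_order all_algebra.
From mathcomp Require Import mpoly.
From mathcomp Require Import zify ring.

Set Implicit Arguments.
Unset Strict Implicit.
Unset Printing Implicit Defensive.

Import Order.TTheory GRing.Theory.
Local Open Scope ring_scope.

(** * Power series *)

Lemma fps_inv_unique (a b : fps) : a 0%N != 0 ->
  fps_mul a b =1 fps_poly 1 -> fps_inv a =1 b.
Proof.
move=> a0 ab d; have: fps_mul a (fps_inv a) =1 fps_mul a b.
  by move=> i; rewrite fps_mulV.
move: (fps_inv a) => c cb; elim/ltn_ind: d => d IHd.
have := cb d; rewrite /fps_mul !big_ord_recl subn0.
have -> : \sum_(i < d) a (lift ord0 i) * c (d - lift ord0 i)%N =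
          \sum_(i < d) a (lift ord0 i) * b (d - lift ord0 i)%N.
  by apply: eq_bigr => i _; rewrite IHd // lift0; have := ltn_ord i; lia.
by move/addIr/(mulfI a0).
Qed.

(** By Pascal's rule, one factor 1 - X turns the coefficients C(i+K+1, K+1) into C(i+K, K). The
    truncation at [D] does not affect the degrees below [D]. *)
Lemma coef_binomial_series (K D d : nat) : (d < D)%N ->
  ((1 - 'X) ^+ K.+1 * \poly_(i < D) ('C(i + K, K)%:R : rat))`_d = (d == 0%N)%:R.
Proof.
elim: K d => [|K IHK] d ltdD.
  rewrite expr1 mulrBl mul1r coefB coefXM !coef_poly ltdD addn0 bin0.
  by case: d ltdD => [|d] ltdD; rewrite ?subr0 //= addn0 bin0 (ltnW ltdD) subrr.
rewrite -(IHK d ltdD) exprSr -mulrA !coefM; apply: eq_bigr => i _.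
congr (_ * _); rewrite mulrBl mul1r coefB coefXM !coef_poly.
have -> : (d - i < D)%N by apply: leq_ltn_trans ltdD; apply: leq_subr.
case E: (d - i)%N => [|e] /=; first by rewrite !add0n !binn subr0.
have -> : (e < D)%N by lia.
have -> : (e.+1 + K = e + K.+1)%N by rewrite addSnnS.
by rewrite addSn binS natrD addrAC subrr add0r.
Qed.

Lemma fps_inv_binomial_series K :
  fps_inv (fps_poly ((1 - 'X) ^+ K.+1)) =1 fun d => 'C(d + K, K)%:R.
Proof.
apply: fps_inv_unique.
  by rewrite /fps_poly -horner_coef0 !hornerE expr1n oner_eq0.
move=> d; rewrite /fps_poly coef1 -(coef_binomial_series K (ltnSn d)) coefM.
apply: eq_bigr => i _; congr (_ * _).
by rewrite coef_poly ltnS leq_subr.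
Qed.

(** Induction on N after multiplication by N + 1, which gives (N+1) C(d+N+1, N+1) = (d+N+1) C(d+N,
    N) on the right. *)
Lemma sum_binomial_product (M N d : nat) :
  (\sum_(e < d.+1) 'C(M, e) * 'C(N, e) * 'C(d - e + (M + N), M + N) =
   'C(d + M, M) * 'C(d + N, N))%N.
Proof.
elim: N => [|N IHN].
  rewrite big_ord_recl big1 => [|i _]; last by rewrite lift0 bin0n muln0.
  by rewrite !bin0 subn0 !addn0 !muln1 mul1n.
apply/eqP; rewrite -(eqn_pmul2l (ltn0Sn N)); apply/eqP.
have -> : (N.+1 * ('C(d + M, M) * 'C(d + N.+1, N.+1)) =
           (d + N.+1) * ('C(d + M, M) * 'C(d + N, N)))%N.
  by rewrite mulnCA addnS -mul_bin_diag mulnCA.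
rewrite -IHN !big_distrr /=.
set K := (M + N)%N; have -> : (M + N.+1 = K.+1)%N by rewrite addnS.
pose X x := 'C(x + K.+1, K.+1).
pose p e := ('C(M, e) * 'C(N, e))%N.
pose pX e := ((M - e) * p e * X (d - e.+1))%N.
(* Pascal's rule for C(N+1, e) and absorption split each term into a share of index e and a share
   [pX] of index e - 1. Once the latter are shifted by one, both sides agree term by term. *)
rewrite (eq_bigr (fun e : 'I_d.+1 => (N.+1 + e) * p e * X (d - e) +
    (if val e is e'.+1 then pX e' else 0)))%N; last first.
  move=> [[|e] lted] _ /=; first by rewrite /p /X !bin0 !addn0 !muln1 !mul1n.
  have -> : pX e = (e.+1 * 'C(M, e.+1) * 'C(N, e) * X (d - e.+1))%N.
    by rewrite /pX /p mulnA -mul_bin_left.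
  rewrite -/(X (d - e.+1)%N) /p mulnA -mulnDl; congr (_ * _)%N.
  rewrite binS; have := mul_bin_left N e; move: 'C(M, e.+1) => c.
  have [leeN|ltNe] := leqP e N.
    have [k ->] : exists k, N = (e + k)%N by exists (N - e)%N; lia.
    rewrite addKn; move: 'C(_, e) 'C(_, e.+1) => a b /(congr1 (muln c)).
    by lia.
  by rewrite !bin_small //; lia.
rewrite big_split /= [X in (_ + X)%N]big_ord_recl add0n.
rewrite big_ord_recr [X in _ = X]big_ord_recr /= addnAC -big_split /=; congr (_ + _)%N.
  apply: eq_bigr => i _; rewrite add0n /pX /X -/(p i).
  have [leiM|ltMi] := leqP i M; last by rewrite /p bin_small // !(mul0n,muln0).
  have lid := ltn_ord i.
  have [y Dy] : exists y, (d - i = y.+1)%N by exists (d - i).-1; lia.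
  have -> : (d - i.+1 = y)%N by lia.
  rewrite Dy [X in (X + N.+1)%N](_ : d = i + y.+1)%N; last by lia.
  have := mul_bin_left (y + K.+1) K; rewrite addSn binS [(y.+1 + K)%N]addSnnS.
  have -> : (y + K.+1 - K = y.+1)%N by lia.
  have [k Dk] : exists k, M = (i + k)%N by exists (M - i)%N; lia.
  rewrite /K; move: 'C(_, (M + N).+1) 'C(_, M + N) (p i) => a b c.
  by rewrite {}Dk addKn => /(congr1 (muln c)); lia.
by rewrite subnn /X !add0n !binn addnC /p; lia.
Qed.

(** This is the Hilbert series of the (M+1) x (N+1) matrices of rank at most 1: the coefficient
    counts pairs of monomials of degree d in M+1 and in N+1 variables. *)
Lemma coef_segre_series (M N : nat) :
  fps_div (fps_poly (\sum_(0 <= e < M.+1) ('C(M, e) * 'C(N, e))%:R *: 'X^e))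
          (fps_poly ((1 - 'X) ^+ (M + N).+1))
  =1 fun d => ('C(d + M, M) * 'C(d + N, N))%:R.
Proof.
move=> d; rewrite -sum_binomial_product natr_sum; apply: eq_bigr => e _.
rewrite fps_inv_binomial_series natrM; congr (_ * _).
rewrite /fps_poly big_mkord coef_sum.
have [leM|ltM] := ltnP e M.+1.
  rewrite (bigD1 (Ordinal leM)) //= coefZ coefXn eqxx mulr1 big1 ?addr0 //.
  by move=> i; rewrite -val_eqE /= coefZ coefXn eq_sym => /negbTE->; rewrite mulr0.
rewrite bin_small // mul0n big1 // => i _.
by rewrite coefZ coefXn gtn_eqF ?mulr0 // (leq_trans (ltn_ord i)).
Qed.

(** * Polynomials in several variables *)

(** A ring morphism is determined by its values on constants and variables; composite substitutions
    are compared this way below. *)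
Lemma rmorph_mpolyE (R : comRingType) (S : comRingType) N
    (g : {rmorphism {mpoly R[N]} -> S}) (p : {mpoly R[N]}) :
  g p = mmap (fun c => g c%:MP) (fun i => g 'X_i) p.
Proof.
rewrite [in LHS](mpolyE p) rmorph_sum; apply: eq_bigr => m _.
rewrite -mul_mpolyC rmorphM mpolyXE_id rmorph_prod; congr (_ * _).
by apply: eq_bigr => i _; rewrite rmorphXn.
Qed.

Lemma mmap_congr (R S : ringType) N (f f' : R -> S) (h h' : 'I_N -> S) p :
  f =1 f' -> h =1 h' -> mmap f h p = mmap f' h' p.
Proof.
move=> ff' hh'; rewrite /mmap; apply: eq_bigr => m _; rewrite ff'.
by congr (_ * _); apply: mmap1_eq.
Qed.

(** Widening the coefficients and evaluating at the last variable undoes [muni]. *)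
Lemma muni_inj (R : comRingType) N : injective (@muni N R).
Proof.
pose g : {rmorphism {mpoly R[N.+1]} -> {mpoly R[N.+1]}} :=
  (horner_eval 'X_ord_max \o map_poly (@mwiden N R)) \o @muni _ _.
apply: (can_inj (g := horner_eval 'X_ord_max \o map_poly (@mwiden N R))) => p.
rewrite -[LHS]/(g p) (rmorph_mpolyE g) [RHS](rmorph_mpolyE idfun).
apply: mmap_congr => [c|i] /=.
  by rewrite /muni mmapC /= map_polyC /= /horner_eval hornerC mwidenC.
rewrite /muni mmapX mmap1U; case: splitP => [j|j] /= Dj.
  rewrite map_polyC /= /horner_eval hornerC mwidenX mnmwiden1.
  by congr ('X__); apply: val_inj.
rewrite map_polyX /horner_eval hornerX; congr ('X__).
by apply: val_inj; rewrite /= Dj ord1 addn0.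
Qed.

(** At a point where the leading coefficient in the last variable does not vanish, a nonzero
    univariate polynomial remains, and it has a nonroot because a closed field is infinite. *)
Lemma mpoly_nonroot (F : closedFieldType) N (p : {mpoly F[N]}) :
  p != 0 -> exists v : 'I_N -> F, p.@[v] != 0.
Proof.
elim: N p => [|N IHN] p p0.
  exists (fun=> 0); move: p0; rewrite (nvar0_mpolyC p).
  by rewrite mevalC mpolyC_eq0.
have q0 : lead_coef (muni p) != 0.
  by rewrite lead_coef_eq0 -(muni0 N F) (inj_eq (@muni_inj F N)).
have [v qv] := IHN _ q0.
pose ev : {rmorphism {mpoly F[N]} -> F} := meval v.
have r0 : map_poly ev (muni p) != 0.
  by apply: contraNneq qv => /polyP/(_ (size (muni p)).-1); rewrite coef_map coef0 => ->.
have /closed_nonrootP[x rx] := r0.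
pose g : {rmorphism {mpoly F[N.+1]} -> F} :=
  (horner_eval x \o map_poly ev) \o @muni _ _.
exists (fun i => g 'X_i).
suff -> : p.@[fun i => g 'X_i] = g p by [].
rewrite (rmorph_mpolyE g) /meval; apply: mmap_congr => // c.
by rewrite /g /= /muni mmapC /= map_polyC /= /horner_eval hornerC mevalC.
Qed.

(** Among the terms with nonzero coefficient, the largest leading monomial cannot cancel. *)
Lemma free_distinct_mlead (R : idomainType) N k (f : 'I_k -> {mpoly R[N]}) :
  (forall i, f i != 0) -> injective (fun i => mlead (f i)) ->
  forall c : 'I_k -> R, \sum_(i < k) c i *: f i = 0 -> forall i, c i = 0.
Proof.
move=> f0 inj_f c sum0 i0; apply/eqP/negPn/negP => ci0.
case: (@arg_maxP _ _ _ i0 (fun i => c i != 0) (fun i => mlead (f i)) ci0).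
move=> i ci max_i; move/(congr1 (mcoeff (mlead (f i))))/eqP: sum0.
rewrite mcoeff0 raddf_sum /= (bigD1 i) //= big1 ?addr0 => [|j ji].
  by rewrite mcoeffZ mulf_eq0 (negbTE ci) mleadc_eq0 (negbTE (f0 i)).
rewrite mcoeffZ; have [->|cj] := eqVneq (c j) 0; first by rewrite mul0r.
rewrite mcoeff_gt_mlead ?mulr0 // lt_neqAle (inj_eq inj_f) ji /=.
exact: max_i.
Qed.

(** A relation between [p] and the free family [b] has a nonzero coefficient at [p], so [p] is a
    combination of [b] modulo [I]. *)
Lemma quot_dim_of_families (F : fieldType) N (I : {mpoly F[N]} -> Prop) d k :
  (exists2 b : 'I_k -> {mpoly F[N]}, forall i, b i \is d.-homog &
     forall c : 'I_k -> F, I (\sum_(i < k) c i *: b i) -> forall i, c i = 0) ->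
  (forall b : 'I_k.+1 -> {mpoly F[N]}, (forall i, b i \is d.-homog) ->
     exists2 c : 'I_k.+1 -> F, exists i, c i != 0 &
       I (\sum_(i < k.+1) c i *: b i)) ->
  is_ideal I -> quot_dim I d k.
Proof.
move=> [b hb free_b] dep idI; exists b; split=> // p hp.
have [|c [i ci] Ic] := dep (fun i => if unlift ord0 i is Some j then b j else p).
  by move=> i; case: (unlift _ _).
move: Ic; rewrite big_ord_recl unlift_none.
under eq_bigr do rewrite liftK.
have [c0|c0] := eqVneq (c ord0) 0.
  rewrite c0 scale0r add0r => /free_b cE; move: ci; case: (unliftP ord0 i).
    by move=> j ->; rewrite cE eqxx.
  by move=> ->; rewrite c0 eqxx.
move=> Ic; exists (fun j => - (c ord0)^-1 * c (lift ord0 j)).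
have := is_idealZ (c ord0)^-1 idI Ic.
rewrite scalerDr scalerA mulVf // scale1r scaler_sumr.
congr I; congr (_ + _); rewrite -sumrN; apply: eq_bigr => j _.
by rewrite scalerA mulNr scaleNr opprK.
Qed.

(** * The tangent parametrization *)

Lemma det_mx22 (R : comRingType) (A : 'M[R]_2) :
  \det A = A ord0 ord0 * A ord_max ord_max - A ord0 ord_max * A ord_max ord0.
Proof.
rewrite (expand_det_row _ ord0) !big_ord_recl big_ord0 addr0 /cofactor !det_mx11.
rewrite !mxE /= expr0 expr1 mul1r mulN1r mulrN.
by congr (_ * A _ _ - A _ _ * A _ _); apply: val_inj.
Qed.

Lemma coef0_mul_linear (R : comRingType) (a b c d : R) :
  ((a%:P + b%:P * 'X) * (c%:P + d%:P * 'X))`_0 = a * c.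
Proof. by rewrite coefM big_ord1 !coefD !coefC !coefMX !addr0. Qed.

Lemma coef1_mul_linear (R : comRingType) (a b c d : R) :
  ((a%:P + b%:P * 'X) * (c%:P + d%:P * 'X))`_1 = a * d + b * c.
Proof.
by rewrite coefM !big_ord_recl big_ord0 /= !coefD !coefC !coefMX !coefC !(addr0, add0r).
Qed.

Lemma coef_det_linear (R : comRingType) m n (x y : 'M[R]_(m, n)) i1 i2 j1 j2
    (M := mxsub (tnth [tuple i1; i2]) (tnth [tuple j1; j2])
            (map_mx polyC x + 'X *: map_mx polyC y)) :
  (\det M)`_0 = x i1 j1 * x i2 j2 - x i1 j2 * x i2 j1 /\
  (\det M)`_1 = x i1 j1 * y i2 j2 + y i1 j1 * x i2 j2
                - (x i1 j2 * y i2 j1 + y i1 j2 * x i2 j1).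
Proof.
have ME i j : M i j = (x (tnth [tuple i1; i2] i) (tnth [tuple j1; j2] j))%:P +
    (y (tnth [tuple i1; i2] i) (tnth [tuple j1; j2] j))%:P * 'X.
  by rewrite !mxE mulrC.
have tnth0 T (a b : T) : tnth [tuple a; b] ord0 = a by [].
have tnth1 T (a b : T) : tnth [tuple a; b] ord_max = b by [].
rewrite det_mx22 !ME !tnth0 !tnth1 !coefB.
by rewrite !coef0_mul_linear !coef1_mul_linear.
Qed.

Section TangentParametrization.
Variables (m n : nat).
Local Notation L := ((m + n) + (m + n))%N.
Local Notation N := (m * n + m * n)%N.

(* The 2 x (m + n) matrix with columns (u_i, s_i), then (v_j, q_j), row by row. *)
Definition idx_u (i : 'I_m) : 'I_L := lshift (m + n) (lshift n i).
Definition idx_v (j : 'I_n) : 'I_L := lshift (m + n) (rshift m j).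
Definition idx_s (i : 'I_m) : 'I_L := rshift (m + n) (lshift n i).
Definition idx_q (j : 'I_n) : 'I_L := rshift (m + n) (rshift m j).

(** The derivative of u v^T in the direction (s, -q). With this sign the velocity entries are, up to
    sign, 2 x 2 minors of the matrix with columns (u_i, s_i) and (v_j, q_j). *)
Definition tangent_jet (S : ringType) (z : 'I_L -> S) : 'rV[S]_N :=
  row_mx (mxvec (\matrix_(i, j) (z (idx_u i) * z (idx_v j))))
         (mxvec (\matrix_(i, j) (z (idx_s i) * z (idx_v j)
                                 - z (idx_u i) * z (idx_q j)))).

Lemma tangent_jetX (S : ringType) (z : 'I_L -> S) i j :
  tangent_jet z ord0 (lshift (m * n) (mxvec_index i j)) = z (idx_u i) * z (idx_v j).
Proof. by rewrite row_mxEl mxvecE mxE. Qed.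

Lemma tangent_jetY (S : ringType) (z : 'I_L -> S) i j :
  tangent_jet z ord0 (rshift (m * n) (mxvec_index i j)) =
  z (idx_s i) * z (idx_v j) - z (idx_u i) * z (idx_q j).
Proof. by rewrite row_mxEr mxvecE mxE. Qed.

Lemma jet_index_ind (P : 'I_N -> Prop) :
  (forall i j, P (lshift (m * n) (mxvec_index i j))) ->
  (forall i j, P (rshift (m * n) (mxvec_index i j))) -> forall k, P k.
Proof.
move=> Pl Pr k; rewrite -(splitK k); case: (split k) => l /=.
  by case/mxvec_indexP: l.
by case/mxvec_indexP: l.
Qed.

Variable F : fieldType.

Definition tangent_map : {mpoly F[N]} -> {mpoly F[L]} :=
  mmap (@mpolyC L F) (tangent_jet (fun k => 'X_k) ord0).

HB.instance Definition _ := GRing.RMorphism.on tangent_map.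

Lemma tangent_map_meval (z : 'I_L -> F) p :
  (tangent_map p).@[z] = p.@[tangent_jet z ord0].
Proof.
rewrite -[LHS]/((meval z \o tangent_map) p) rmorph_mpolyE.
apply: mmap_congr => [c|k] /=; first by rewrite /tangent_map mmapC mevalC.
rewrite /tangent_map mmapX mmap1U; elim/jet_index_ind: k => i j.
  by rewrite !tangent_jetX mevalM !mevalXU.
by rewrite !tangent_jetY mevalB !mevalM !mevalXU.
Qed.

Definition jet_base (v : 'rV[F]_N) : 'M_(m, n) := vec_mx (lsubmx v).
Definition jet_velocity (v : 'rV[F]_N) : 'M_(m, n) := vec_mx (rsubmx v).

Lemma minor2_jetE (i1 i2 : 'I_m) (j1 j2 : 'I_n) (v : 'rV[F]_N)
    (X := jet_base v) (Y := jet_velocity v) :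
  ((minor2 (gen_jet F m n) i1 i2 j1 j2)`_0).@[v ord0] =
    X i1 j1 * X i2 j2 - X i1 j2 * X i2 j1 /\
  ((minor2 (gen_jet F m n) i1 i2 j1 j2)`_1).@[v ord0] =
    X i1 j1 * Y i2 j2 + Y i1 j1 * X i2 j2 - (X i1 j2 * Y i2 j1 + Y i1 j2 * X i2 j1).
Proof.
have eX i j : (genX F m n i j).@[v ord0] = X i j by rewrite !mxE mevalXU.
have eY i j : (genY F m n i j).@[v ord0] = Y i j by rewrite !mxE mevalXU.
have [e0 e1] := coef_det_linear (genX F m n) (genY F m n) i1 i2 j1 j2.
rewrite /minor2 /gen_jet; split; [rewrite [_`_0]e0 | rewrite [_`_1]e1];
  by rewrite !(mevalB, mevalD, mevalM, eX, eY).
Qed.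

Lemma zero_locus_gen (G : {mpoly F[N]} -> Prop) v :
  zero_locus (ideal_gen G) v <-> forall g, G g -> g.@[v ord0] = 0.
Proof.
split=> [v0 g Gg|v0 p]; first by apply: v0 => I _; apply.
move/(_ (fun p => p.@[v ord0] = 0)); apply=> //.
split=> [|f g f0 g0|r f f0]; first exact: meval0.
  by rewrite mevalD f0 g0 addr0.
by rewrite mevalM f0 mulr0.
Qed.

Definition jet_eqs (X Y : 'M[F]_(m, n)) : Prop := forall i1 i2 j1 j2,
  X i1 j1 * X i2 j2 - X i1 j2 * X i2 j1 = 0 /\
  X i1 j1 * Y i2 j2 + Y i1 j1 * X i2 j2 - (X i1 j2 * Y i2 j1 + Y i1 j2 * X i2 j1) = 0.

(** The generators use increasing pairs of rows and columns only. The equations change sign when two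
    rows or two columns are exchanged and are trivial when they coincide. *)
Lemma jetsP v : jets v <-> jet_eqs (jet_base v) (jet_velocity v).
Proof.
rewrite /jets /jet_ideal zero_locus_gen; split; last first.
  move=> eqs _ [i1 [i2 [j1 [j2 [k [_ _ ltk2 ->]]]]]].
  have [e0 e1] := minor2_jetE i1 i2 j1 j2 v; have [z0 z1] := eqs i1 i2 j1 j2.
  by case: k ltk2 => [|[|//]] _; rewrite ?e0 ?e1.
move=> v0; set X := jet_base v; set Y := jet_velocity v.
have eqs (i1 i2 : 'I_m) (j1 j2 : 'I_n) : (i1 < i2)%N -> (j1 < j2)%N ->
  X i1 j1 * X i2 j2 - X i1 j2 * X i2 j1 = 0 /\
  X i1 j1 * Y i2 j2 + Y i1 j1 * X i2 j2 - (X i1 j2 * Y i2 j1 + Y i1 j2 * X i2 j1) = 0.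
  move=> lti ltj; have [<- <-] := minor2_jetE i1 i2 j1 j2 v.
  by split; apply: v0; exists i1, i2, j1, j2; [exists 0%N | exists 1%N].
have eqsj (i1 i2 : 'I_m) j1 j2 : (i1 < i2)%N ->
  X i1 j1 * X i2 j2 - X i1 j2 * X i2 j1 = 0 /\
  X i1 j1 * Y i2 j2 + Y i1 j1 * X i2 j2 - (X i1 j2 * Y i2 j1 + Y i1 j2 * X i2 j1) = 0.
  move=> lti; case: (ltngtP j1 j2) => [ltj|gtj|/val_inj->]; first exact: eqs.
    have [e0 e1] := eqs _ _ _ _ lti gtj.
    by split; apply: oppr_inj; rewrite oppr0; [rewrite -[RHS]e0 | rewrite -[RHS]e1]; ring.
  by split; ring.
move=> i1 i2 j1 j2; case: (ltngtP i1 i2) => [lti|gti|/val_inj->]; first exact: eqsj.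
  have [e0 e1] := eqsj _ _ j1 j2 gti.
  by split; apply: oppr_inj; rewrite oppr0; [rewrite -[RHS]e0 | rewrite -[RHS]e1]; ring.
by split; ring.
Qed.

Lemma jet_ext (v w : 'rV[F]_N) :
  jet_base v = jet_base w -> jet_velocity v = jet_velocity w -> v = w.
Proof.
move=> /(can_inj vec_mxK) eX /(can_inj vec_mxK) eY.
by rewrite -[v]hsubmxK -[w]hsubmxK eX eY.
Qed.

Lemma tangent_jet_base (z : 'I_L -> F) i j :
  jet_base (tangent_jet z) i j = z (idx_u i) * z (idx_v j).
Proof. by rewrite /jet_base row_mxKl mxvecK mxE. Qed.

Lemma tangent_jet_velocity (z : 'I_L -> F) i j :
  jet_velocity (tangent_jet z) i j =
  z (idx_s i) * z (idx_v j) - z (idx_u i) * z (idx_q j).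
Proof. by rewrite /jet_velocity row_mxKr mxvecK mxE. Qed.

Lemma jets_over_smooth_tangent (z : 'I_L -> F) i0 j0 :
  z (idx_u i0) != 0 -> z (idx_v j0) != 0 -> jets_over_smooth (tangent_jet z).
Proof.
move=> zu zv; split.
  apply/jetsP => i1 i2 j1 j2; rewrite !tangent_jet_base !tangent_jet_velocity.
  by split; ring.
rewrite -/(jet_base _); split.
  have -> : jet_base (tangent_jet z) =
      (\col_i z (idx_u i)) *m (\row_j z (idx_v j)).
    by apply/matrixP => i j; rewrite tangent_jet_base !mxE big_ord1 !mxE.
  exact: leq_trans (mxrankM_maxr _ _) (rank_leq_row _).
apply/eqP => /matrixP/(_ i0 j0)/eqP; rewrite tangent_jet_base !mxE.
by rewrite mulf_eq0 (negbTE zu) (negbTE zv).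
Qed.

Lemma jets_over_smoothE (v : 'rV[F]_N) :
  jets_over_smooth v -> exists z : 'I_L -> F, v = tangent_jet z.
Proof.
case=> /jetsP eqs [_ X0]; rewrite -/(jet_base v) in X0.
set X := jet_base v in eqs X0; set Y := jet_velocity v in eqs.
have [[i0 j0] /= X00] : exists ij : 'I_m * 'I_n, X ij.1 ij.2 != 0.
  apply/existsP; apply: contraNT X0 => /existsPn X0.
  by apply/eqP/matrixP => i j; have /negPn/eqP /= -> := X0 (i, j); rewrite mxE.
(* u and s are column [j0] of [X] and of [Y]; v is row [i0] of [X], scaled so that its entry at [j0]
   is 1; q is solved from row [i0] of the velocity equation. *)
pose z k : F := match split k with
  | inl x => match split x with
             | inl i => X i j0
             | inr j => X i0 j / X i0 j0
             end
  | inr x => match split x with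
             | inl i => Y i j0
             | inr j => (Y i0 j0 * (X i0 j / X i0 j0) - Y i0 j) / X i0 j0
             end
  end.
have zu i : z (idx_u i) = X i j0 by rewrite /z !(unsplitK (inl _)).
have zv j : z (idx_v j) = X i0 j / X i0 j0.
  by rewrite /z (unsplitK (inl _)) (unsplitK (inr _)).
have zs i : z (idx_s i) = Y i j0.
  by rewrite /z (unsplitK (inr _)) (unsplitK (inl _)).
have zq j : z (idx_q j) = (Y i0 j0 * (X i0 j / X i0 j0) - Y i0 j) / X i0 j0.
  by rewrite /z !(unsplitK (inr _)).
exists z; apply: jet_ext; apply/matrixP => i j.
  rewrite tangent_jet_base zu zv -/X; have [e0 _] := eqs i0 i j0 j.
  apply: (mulfI X00); rewrite -[LHS]subr0 -[X in _ - X]e0; field.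
  exact: X00.
rewrite tangent_jet_velocity zu zv zs zq -/Y; have [e0 e1] := eqs i0 i j0 j.
have eX : X i j = X i0 j * X i j0 / X i0 j0.
  apply: (mulfI X00); rewrite -[LHS]subr0 -[X in _ - X]e0; field.
  exact: X00.
apply: (mulfI X00); rewrite -[LHS]subr0 -[X in _ - X]e1 eX; field.
exact: X00.
Qed.

Lemma vanishing_ideal_closure (S : 'rV[F]_N -> Prop) p :
  vanishing_ideal (zariski_closure S) p <-> vanishing_ideal S p.
Proof.
split=> [p0 v Sv|p0 v]; first by apply: p0 => I _; apply.
move/(_ _ (vanishing_ideal_is_ideal S)); apply=> // w Sw q; exact.
Qed.

End TangentParametrization.

(** The jets over the smooth locus lie in the image of the parametrization and contain the image of
    a dense open set, so vanishing on them means that the pullback is zero. *)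
Lemma principal_idealP (F : closedFieldType) (m n : nat) :
  (0 < m)%N -> (0 < n)%N ->
  forall p, @principal_ideal F m n p <-> tangent_map p = 0.
Proof.
move=> m0 n0 p; rewrite /principal_ideal /principal_component.
rewrite vanishing_ideal_closure; split=> [p0|p0 v /jets_over_smoothE[z ->]].
  apply/eqP/negPn/negP => tp0; pose i0 := Ordinal m0; pose j0 := Ordinal n0.
  (* The two extra factors force u and v to be nonzero at the chosen point, so that its jet lies
     over the smooth locus. *)
  have [|z] := @mpoly_nonroot F _ (tangent_map p * 'X_(idx_u n i0) * 'X_(idx_v m j0)).
    by rewrite !mulf_neq0 // -?mleadc_eq0 ?mleadXm ?mcoeffX ?eqxx ?oner_eq0.
  rewrite !mevalM !mevalXU !mulf_eq0 !negb_or -andbA => /and3P[pz zu zv].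
  move: pz; rewrite tangent_map_meval p0 ?eqxx //.
  exact: jets_over_smooth_tangent zu zv.
by rewrite -tangent_map_meval p0 meval0.
Qed.

(** * Brackets and ballot monomials *)

(* A pair (a, b) stands for b letters "-" followed by a letters "+", where a "-"
   cancels an earlier unmatched "+".  There are h unmatched "+" so far; [to_ballot]
   turns each unmatchable "-" into a "+", and j counts the unmatched "+" that come
   from an original "-".  At the end j is half the weight, which is why the final
   word of a weight 0 word determines it. *)
Fixpoint to_ballot (h j : nat) (t : seq (nat * nat)) : seq (nat * nat) :=
  if t is (a, b) :: t' then
    let q := minn (h - j) b in
    (a + b - q, q)%N :: to_ballot (h + a + b - q.*2) (j + b - q) t'
  else [::].

(** In each pair the [-] come before the [+], so that a column is matched only with strictly earlier
    columns. *)
Fixpoint ballot (h : nat) (t : seq (nat * nat)) : bool :=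
  if t is (a, b) :: t' then (b <= h)%N && ballot (h - b + a) t' else true.

Lemma size_to_ballot h j t : size (to_ballot h j t) = size t.
Proof. by elim: t h j => //= -[a b] t IHt h j /=; rewrite IHt. Qed.

Lemma ballot_to_ballot h j t : (j <= h)%N -> ballot h (to_ballot h j t).
Proof.
elim: t h j => //= -[a b] t IHt h j lejh /=.
have -> : (h - minn (h - j) b + (a + b - minn (h - j) b) =
           h + a + b - (minn (h - j) b).*2)%N by lia.
by rewrite IHt; lia.
Qed.

Lemma to_ballot_content h j t :
  [seq (x.1 + x.2)%N | x <- to_ballot h j t] = [seq (x.1 + x.2)%N | x <- t].
Proof.
elim: t h j => //= -[a b] t IHt h j /=; rewrite IHt; congr (_ :: _).
by lia.
Qed.

(** Steps are undone from the last one back: equal outputs carry the last hypothesis along, and at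
    the end of the words it equates the counters. Backwards, comparing [q] with [h] minus the new
    counter tells whether all the [-] of the pair were cancelled, which recovers [b] and [j]. *)
Lemma to_ballot_inj h j j' t t' : (j <= h)%N -> (j' <= h)%N ->
  to_ballot h j t = to_ballot h j' t' ->
  (j + sumn (unzip2 t) = j' + sumn (unzip2 t'))%N -> j = j' /\ t = t'.
Proof.
elim: t t' h j j' => [|[a b] t IHt] [|[a' b'] t'] h j j' lejh lej'h //=.
  by rewrite !addn0.
case=> Ea Eq Et; have Eh : (h + a' + b' - (minn (h - j') b').*2 =
  h + a + b - (minn (h - j) b).*2)%N by lia.
rewrite Eh in Et => Es.
have [|||Ej ->] := IHt _ _ _ _ _ _ Et; [by lia.. |].
have [Eb Ej'] : b = b' /\ j = j' by lia.
have Ea' : a = a' by lia.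
by rewrite Ea' Eb Ej'.
Qed.

(** * Bracket products in the algebra of the tangent parametrization *)

Section Brackets.
Variables (F : fieldType) (m n : nat).
Local Notation L := ((m + n) + (m + n))%N.
Local Notation N := (m * n + m * n)%N.
Local Notation P := {mpoly F[L]}.
Implicit Types (x y : 'I_(m + n)) (f g : P).

Definition row1 x : P := 'X_(lshift (m + n) x).
Definition row2 x : P := 'X_(rshift (m + n) x).
Definition bracket x y : P := row1 x * row2 y - row1 y * row2 x.

Lemma tangent_mapX i j : tangent_map (genX F m n i j) =
  row1 (lshift n i) * row1 (rshift m j).
Proof. by rewrite mxE /tangent_map mmapX mmap1U tangent_jetX. Qed.

Lemma tangent_mapY i j : tangent_map (genY F m n i j) =
  - bracket (lshift n i) (rshift m j).
Proof.
rewrite mxE /tangent_map mmapX mmap1U tangent_jetY opprB mulrC.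
by rewrite [row1 _ * row2 _]mulrC.
Qed.

Definition in_jet_algebra (d : nat) f : Prop :=
  exists2 g : {mpoly F[N]}, g \is d.-homog & tangent_map g = f.

Lemma in_jet_algebra1 : in_jet_algebra 0 1.
Proof. by exists 1; [apply: dhomog1 | apply: rmorph1]. Qed.

Lemma in_jet_algebraM d e f g :
  in_jet_algebra d f -> in_jet_algebra e g -> in_jet_algebra (d + e) (f * g).
Proof.
by move=> [a ha <-] [b hb <-]; exists (a * b); [apply: dhomogM | apply: rmorphM].
Qed.

Lemma in_jet_algebraB d f g :
  in_jet_algebra d f -> in_jet_algebra d g -> in_jet_algebra d (f - g).
Proof.
by move=> [a ha <-] [b hb <-]; exists (a - b); [apply: rpredB | apply: rmorphB].
Qed.

Lemma in_jet_algebra_uv i j :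
  in_jet_algebra 1 (row1 (lshift n i) * row1 (rshift m j)).
Proof.
by exists (genX F m n i j); [rewrite mxE dhomogX /= mdeg1 | apply: tangent_mapX].
Qed.

Lemma in_jet_algebra_bracket i j :
  in_jet_algebra 1 (bracket (lshift n i) (rshift m j)).
Proof.
exists (- genY F m n i j); first by rewrite rpredN mxE dhomogX /= mdeg1.
by rewrite rmorphN /= tangent_mapY opprK.
Qed.

(** The three-term relation u_k [v_j v_l] = v_j [u_k v_l] - v_l [u_k v_j], multiplied by u_i. *)
Lemma in_jet_algebra_uu i k j l :
  in_jet_algebra 2 (row1 (lshift n i) * row1 (lshift n k) *
                    bracket (rshift m j) (rshift m l)).
Proof.
have -> : row1 (lshift n i) * row1 (lshift n k) * bracket (rshift m j) (rshift m l) =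
    row1 (lshift n i) * row1 (rshift m j) * bracket (lshift n k) (rshift m l) -
    row1 (lshift n i) * row1 (rshift m l) * bracket (lshift n k) (rshift m j).
  by rewrite /bracket; ring.
apply: in_jet_algebraB; apply: (@in_jet_algebraM 1 1);
  by [apply: in_jet_algebra_uv | apply: in_jet_algebra_bracket].
Qed.

Lemma in_jet_algebra_vv i k j l :
  in_jet_algebra 2 (bracket (lshift n i) (lshift n k) *
                    (row1 (rshift m j) * row1 (rshift m l))).
Proof.
have -> : bracket (lshift n i) (lshift n k) * (row1 (rshift m j) * row1 (rshift m l)) =
    row1 (lshift n k) * row1 (rshift m j) * bracket (lshift n i) (rshift m l) -
    row1 (lshift n i) * row1 (rshift m j) * bracket (lshift n k) (rshift m l).
  by rewrite /bracket; ring.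
apply: in_jet_algebraB; apply: (@in_jet_algebraM 1 1);
  by [apply: in_jet_algebra_uv | apply: in_jet_algebra_bracket].
Qed.

(** The Plücker relation expresses the product through mixed brackets, which are generators up to
    sign. *)
Lemma in_jet_algebra_bracket2 i k j l :
  in_jet_algebra 2 (bracket (lshift n i) (lshift n k) *
                    bracket (rshift m j) (rshift m l)).
Proof.
have -> : bracket (lshift n i) (lshift n k) * bracket (rshift m j) (rshift m l) =
    bracket (lshift n i) (rshift m j) * bracket (lshift n k) (rshift m l) -
    bracket (lshift n i) (rshift m l) * bracket (lshift n k) (rshift m j).
  by rewrite /bracket; ring.
by apply: in_jet_algebraB; apply: (@in_jet_algebraM 1 1); apply: in_jet_algebra_bracket.
Qed.

Definition bracket_prod (s : seq 'I_(m + n)) (t : seq ('I_(m + n) * 'I_(m + n))) : P :=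
  (\prod_(x <- s) row1 x) * \prod_(xy <- t) bracket xy.1 xy.2.

Lemma bracket_prod_cons x s t :
  bracket_prod (x :: s) t = row1 x * bracket_prod s t.
Proof. by rewrite /bracket_prod big_cons mulrA. Qed.

Lemma bracket_prod_cons2 x y s t :
  bracket_prod s ((x, y) :: t) = bracket x y * bracket_prod s t.
Proof. by rewrite /bracket_prod big_cons mulrCA. Qed.

(** Equal degrees on both sides allow the factors to be grouped into the products treated above: u
    with v, two u with a v-bracket, a u-bracket with two v, and two brackets. *)
Lemma in_jet_algebra_separated (us : seq 'I_m) ub (vs : seq 'I_n) vb :
  (size us + (size ub).*2 = size vs + (size vb).*2)%N ->
  in_jet_algebra (size us + (size ub).*2)
    (bracket_prod (map (@lshift m n) us) [seq (lshift n ik.1, lshift n ik.2) | ik <- ub] *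
     bracket_prod (map (@rshift m n) vs) [seq (rshift m jl.1, rshift m jl.2) | jl <- vb]).
Proof.
elim: ub us vs vb => [|[i k] ub IHub] us vs vb.
  elim: vb us vs => [|[j l] vb IHvb] us vs.
    elim: us vs => [|i us IHus] [|j vs] //=.
      by rewrite /bracket_prod !big_nil !mul1r => _; apply: in_jet_algebra1.
    move=> sz; rewrite !bracket_prod_cons mulrACA addSn -add1n.
    by apply: in_jet_algebraM (in_jet_algebra_uv i j) (IHus vs _) => /=; lia.
  case: us => [|i [|k us]] /= sz; try by lia.
  rewrite !bracket_prod_cons bracket_prod_cons2 [row1 _ * (row1 _ * _)]mulrA mulrACA.
  by apply: in_jet_algebraM (in_jet_algebra_uu i k j l) (IHvb us vs _) => /=; lia.
have -> : (size us + (size ((i, k) :: ub)).*2 = 2 + (size us + (size ub).*2))%N.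
  by rewrite /=; lia.
case: vb => [|[j l] vb] sz /=.
  case: vs sz => [|j [|l vs]] /= sz; try by lia.
  rewrite bracket_prod_cons2 !bracket_prod_cons [row1 _ * (row1 _ * _)]mulrA mulrACA.
  by apply: in_jet_algebraM (in_jet_algebra_vv i k j l) (IHub us vs [::] _) => /=; lia.
rewrite !bracket_prod_cons2 mulrACA.
apply: in_jet_algebraM (in_jet_algebra_bracket2 i k j l) (IHub us vs vb _).
by move: sz => /=; lia.
Qed.

End Brackets.

(** * Leading monomials of bracket products *)

Section LeadingMonomials.
Variables (F : fieldType) (m n : nat).
Local Notation L := ((m + n) + (m + n))%N.
Local Notation P := {mpoly F[L]}.
Implicit Types (x y : 'I_(m + n)) (xy : 'I_(m + n) * 'I_(m + n)).
Implicit Types (s : seq 'I_(m + n)) (t : seq ('I_(m + n) * 'I_(m + n))).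

Definition letter_count (w : 'I_(m + n) -> nat) s t : nat :=
  \sum_(x <- s) w x + \sum_(xy <- t) (w xy.1 + w xy.2).

Definition in_u x : nat := (x < m)%N.
Definition in_v x : nat := (m <= x)%N.

(** Mixed brackets are generators up to sign and are collected in [Y]. Each has degree 1 in both
    groups of columns, so the remaining degrees in u and in v both drop by [k]. *)
Lemma bracket_prod_separate s t : all (fun xy => xy.1 < xy.2)%N t ->
  exists k (Y : P) (us : seq 'I_m) ub (vs : seq 'I_n) vb,
  [/\ in_jet_algebra k Y,
      bracket_prod F s t = Y *
      (bracket_prod F (map (@lshift m n) us) [seq (lshift n ik.1, lshift n ik.2) | ik <- ub] *
       bracket_prod F (map (@rshift m n) vs) [seq (rshift m jl.1, rshift m jl.2) | jl <- vb]),
      letter_count in_u s t = (k + (size us + (size ub).*2))%N &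
      letter_count in_v s t = (k + (size vs + (size vb).*2))%N].
Proof.
elim: t => [|[x y] t IHt] /=.
  move=> _; elim: s => [|x s [k [Y [us [ub [vs [vb [HY E cu cv]]]]]]]].
    exists 0%N, 1, [::], [::], [::], [::]; split; first exact: in_jet_algebra1.
    - by rewrite /bracket_prod !big_nil !mul1r.
    - by rewrite /letter_count !big_nil.
    - by rewrite /letter_count !big_nil.
  move: cu cv; rewrite /letter_count !big_nil !addn0 => cu cv.
  case: (split_ordP x) => [i|j] ->.
    exists k, Y, (i :: us), ub, vs, vb; split=> //.
    - by rewrite bracket_prod_cons E /= bracket_prod_cons; ring.
    - by rewrite big_cons cu /in_u /= ltn_ord; lia.
    - by rewrite big_cons cv /in_v /= leqNgt ltn_ord.
  exists k, Y, us, ub, (j :: vs), vb; split=> //.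
  - by rewrite bracket_prod_cons E /= bracket_prod_cons; ring.
  - by rewrite big_cons cu /in_u /= ltnNge leq_addr.
  - by rewrite big_cons cv /in_v /= leq_addr; lia.
case/andP=> ltxy /IHt[k [Y [us [ub [vs [vb [HY E cu cv]]]]]]].
have cW w : letter_count w s ((x, y) :: t) = (w x + w y + letter_count w s t)%N.
  by rewrite /letter_count big_cons /= addnCA.
rewrite !cW cu cv bracket_prod_cons2 E; move: ltxy.
have uL i : in_u (lshift n i) = 1%N by rewrite /in_u /= ltn_ord.
have vL i : in_v (lshift n i) = 0%N by rewrite /in_v /= leqNgt ltn_ord.
have uR j : in_u (rshift m j) = 0%N by rewrite /in_u /= ltnNge leq_addr.
have vR j : in_v (rshift m j) = 1%N by rewrite /in_v /= leq_addr.
case: (split_ordP x) => [i|j] ->; case: (split_ordP y) => [k'|l] -> ltxy;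
  rewrite ?uL ?vL ?uR ?vR.
- exists k, Y, us, ((i, k') :: ub), vs, vb; split=> //=; try lia.
  by rewrite bracket_prod_cons2; ring.
- exists k.+1, (bracket F (lshift n i) (rshift m l) * Y), us, ub, vs, vb.
  split=> //; first exact: in_jet_algebraM (in_jet_algebra_bracket F i l) HY.
  by rewrite mulrA.
- by move: ltxy; rewrite /= ltnNge (leq_trans (ltnW (ltn_ord _))) ?leq_addr.
- exists k, Y, us, ub, vs, ((j, l) :: vb); split=> //=; try lia.
  by rewrite bracket_prod_cons2; ring.
Qed.

Lemma bracket_prod_in_jet_algebra d s t : all (fun xy => xy.1 < xy.2)%N t ->
  letter_count in_u s t = d -> letter_count in_v s t = d ->
  in_jet_algebra d (bracket_prod F s t).
Proof.
move=> /(bracket_prod_separate s)[k [Y [us [ub [vs [vb [HY -> -> ->]]]]]]] <- /addnI E.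
by apply: in_jet_algebraM HY _; apply: in_jet_algebra_separated.
Qed.

(** Both terms have degree 2, and the variable of least index, [row1 x], occurs in the diagonal term
    only; at equal degree, a larger exponent at the first difference wins. *)
Lemma mlead_bracket x y : (x < y)%N ->
  mlead (bracket F x y) = (U_(lshift (m + n) x) + U_(rshift (m + n) y))%MM.
Proof.
move=> ltxy; rewrite /bracket /row1 /row2 -!mpolyXD.
rewrite mleadDl mleadXm // mleadN mleadXm.
apply/ltmcP; first by rewrite !mdegD !mdeg1.
exists (lshift (m + n) x) => [z ltz|]; rewrite !mnmDE !mnm1E -!val_eqE /=.
  have := ltn_ord x; have /= := ltz; move: (nat_of_ord z) => k; lia.
by have := ltn_ord x; lia.
Qed.

Lemma bracket_neq0 x y : (x < y)%N -> bracket F x y != 0.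
Proof.
move=> /mlead_bracket E; apply: contraTneq isT => b0; move: E.
by rewrite b0 mlead0 => /(congr1 mdeg); rewrite mdegD !mdeg1 mdeg0.
Qed.

Lemma row1_neq0 x : row1 F x != 0.
Proof. by rewrite -mleadc_eq0 mleadXm mcoeffX eqxx oner_eq0. Qed.

Lemma bracket_prod_neq0 s t : all (fun xy => xy.1 < xy.2)%N t ->
  bracket_prod F s t != 0.
Proof.
move=> /allP lt_t; rewrite mulf_neq0 //.
  by rewrite prodf_seq_neq0; apply/allP => x _; apply: row1_neq0.
by rewrite prodf_seq_neq0; apply/allP => xy /lt_t /bracket_neq0.
Qed.

Variables alpha beta : 'I_(m + n) -> nat.

(** Parenthesis matching: [stack] holds the open first-row letters. A column [x] closes [beta x] of
    them into brackets, possible by the ballot condition, and then pushes [alpha x] copies of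
    itself. Letters still open at the end become [row1] factors. *)
Lemma ballot_bracket_prod (letters stack : seq 'I_(m + n)) :
  pairwise (fun x y => x < y)%N letters ->
  allrel (fun x y => x < y)%N stack letters ->
  ballot (size stack) [seq (alpha x, beta x) | x <- letters] ->
  exists s t, [/\ all (fun xy => xy.1 < xy.2)%N t,
    mlead (bracket_prod F s t) =
      (\sum_(x <- stack) U_(lshift (m + n) x) +
       \sum_(x <- letters) (U_(lshift (m + n) x) *+ alpha x
                            + U_(rshift (m + n) x) *+ beta x))%MM &
    forall w, letter_count w s t =
      (\sum_(x <- stack) w x + \sum_(x <- letters) (alpha x + beta x) * w x)%N].
Proof.
elim: letters stack => [|x ls IHls] stack /=.
  move=> _ _ _; exists stack, [::]; split=> //.
    rewrite /bracket_prod !big_nil mulr1 addm0 mlead_prod => [|x _ _].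
      by apply: eq_bigr => x _; rewrite mleadXm.
    exact: row1_neq0.
  by move=> w; rewrite /letter_count !big_nil.
case/andP=> lt_x ls_pw; rewrite allrel_consr => /andP[st_x st_ls].
case/andP=> le_beta bal.
pose st1 := take (beta x) stack; pose st2 := drop (beta x) stack.
have Dst : stack = st1 ++ st2 by rewrite cat_take_drop.
have sz1 : size st1 = beta x by rewrite size_takel.
have [|||s [t [lt_t lead_st cnt]]] := IHls (nseq (alpha x) x ++ st2).
- exact: ls_pw.
- rewrite allrel_catl; apply/andP; split.
    by apply/allrelP => y z /nseqP[-> _] /(allP lt_x).
  by move: st_ls; rewrite Dst allrel_catl => /andP[].
- by rewrite size_cat size_nseq size_drop addnC.
exists s, ([seq (y, x) | y <- st1] ++ t).
have lt_st1 : all (fun xy => xy.1 < xy.2)%N [seq (y, x) | y <- st1].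
  rewrite all_map; apply/allP => y y1 /=; apply: (allP st_x).
  by rewrite Dst mem_cat y1.
split; first by rewrite all_cat lt_st1.
- have -> : bracket_prod F s ([seq (y, x) | y <- st1] ++ t) =
            (\prod_(y <- st1) bracket F y x) * bracket_prod F s t.
    by rewrite /bracket_prod big_cat big_map mulrCA.
  have st1P y : y \in st1 -> (y < x)%N.
    by move=> y1; apply: (allP st_x); rewrite Dst mem_cat y1.
  rewrite mleadM ?bracket_prod_neq0 //; last first.
    by rewrite prodf_seq_neq0; apply/allP => y /st1P /bracket_neq0.
  rewrite mlead_prod => [|y /st1P ltyx _]; last exact: bracket_neq0.
  have -> : (\sum_(y <- st1) mlead (bracket F y x) =
             \sum_(y <- st1) (U_(lshift (m + n) y) + U_(rshift (m + n) x)))%MM.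
    by apply: eq_big_seq => y /st1P /mlead_bracket.
  rewrite lead_st big_cons Dst !big_cat /= big_split /= !big_const_seq !count_predT.
  rewrite sz1 !big_nseq.
  have iterE (u : 'X_{1..L}) k : iter k (mnm_add u) 0%MM = (u *+ k)%MM.
    apply/mnmP => z; rewrite mulmnE; elim: k => [|k IHk].
      by rewrite mnm0E muln0.
    by rewrite mnmDE IHk mulnS.
  rewrite !iterE; apply/mnmP => z; rewrite !(mnmDE, mulmnE).
  by lia.
move=> w; have := cnt w; rewrite /letter_count !big_cat big_map /= => E.
rewrite addnCA E Dst big_cat big_cons big_split /= big_const_seq count_predT sz1.
by rewrite iter_addn_0 big_nseq iter_addn_0; lia.
Qed.

End LeadingMonomials.

(** * Balanced monomials and the lower bound *)

Section BalancedMonomials.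
Variables (m n : nat).
Local Notation L := ((m + n) + (m + n))%N.
Local Notation r := (m + n)%N.
Implicit Types (mu : 'X_{1..L}).

Definition join_mnm (c : 'X_{1..m} * 'X_{1..n} * ('X_{1..m} * 'X_{1..n})) : 'X_{1..L} :=
  [multinom match split k with
            | inl x => match split x with inl i => c.1.1 i | inr j => c.1.2 j end
            | inr x => match split x with inl i => c.2.1 i | inr j => c.2.2 j end
            end | k < L].

Definition split_mnm mu : 'X_{1..m} * 'X_{1..n} * ('X_{1..m} * 'X_{1..n}) :=
  ([multinom mu (idx_u n i) | i < m], [multinom mu (idx_v m j) | j < n],
   ([multinom mu (idx_s n i) | i < m], [multinom mu (idx_q m j) | j < n])).

Lemma join_mnmK : cancel join_mnm split_mnm.
Proof.
case=> [[U V] [W Q]]; congr (_, _, (_, _)); apply/mnmP => i; rewrite !mnmE.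
- by rewrite !(unsplitK (inl _)).
- by rewrite (unsplitK (inl _)) (unsplitK (inr _)).
- by rewrite (unsplitK (inr _)) (unsplitK (inl _)).
- by rewrite !(unsplitK (inr _)).
Qed.

Lemma split_mnmK : cancel split_mnm join_mnm.
Proof.
move=> mu; apply/mnmP => k; rewrite mnmE.
by case: (split_ordP k) => x ->; case: (split_ordP x) => i ->; rewrite mnmE.
Qed.

Definition balanced (d : nat) mu : bool :=
  let: c := split_mnm mu in
  [&& mdeg c.1.1 == mdeg c.1.2, mdeg c.2.1 == mdeg c.2.2
    & (mdeg c.1.1 + mdeg c.2.1 == d)%N].

Lemma balancedP d mu : balanced d mu <->
  [/\ \sum_i mu (idx_u n i) = \sum_j mu (idx_v m j),
      \sum_i mu (idx_s n i) = \sum_j mu (idx_q m j)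
    & \sum_i mu (idx_u n i) + \sum_i mu (idx_s n i) = d]%N.
Proof.
have mdegF k (f : 'I_k -> nat) : mdeg [multinom f i | i < k] = (\sum_i f i)%N.
  by rewrite mdegE; apply: eq_bigr => i _; rewrite mnmE.
rewrite /balanced /split_mnm /= !mdegF.
by split=> [/and3P[/eqP-> /eqP-> /eqP]|[-> -> ->]] //; rewrite !eqxx.
Qed.

(* The rows are exchanged in the columns (v_j, q_j), so that a balanced monomial,
   for which deg s + deg v = deg u + deg q, becomes a word of weight 0. *)
Definition word mu : seq (nat * nat) :=
  [seq if (x < m)%N then (mu (lshift r x), mu (rshift r x))
       else (mu (rshift r x), mu (lshift r x)) | x : 'I_r <- enum 'I_r].

Lemma nth_word mu (x : 'I_r) : nth (0, 0)%N (word mu) x =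
  if (x < m)%N then (mu (lshift r x), mu (rshift r x))
  else (mu (rshift r x), mu (lshift r x)).
Proof. by rewrite (nth_map x) ?nth_ord_enum // size_enum_ord. Qed.

Lemma size_word mu : size (word mu) = r.
Proof. by rewrite size_map size_enum_ord. Qed.

Definition ballot_exp mu (x : 'I_r) : nat * nat :=
  nth (0, 0)%N (to_ballot 0 0 (word mu)) x.

(** The rows are not exchanged back in the last [n] columns: the ballot word is read on the 2 x (m +
    n) matrix itself, and only the column sums agree with those of [mu]. *)
Definition ballot_mnm mu : 'X_{1..L} :=
  [multinom match split k with
            | inl x => (ballot_exp mu x).1
            | inr x => (ballot_exp mu x).2
            end | k < L].

Lemma map_ballot_exp mu :
  [seq ((ballot_exp mu x).1, (ballot_exp mu x).2) | x <- enum 'I_r] =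
  to_ballot 0 0 (word mu).
Proof.
apply: (@eq_from_nth _ (0, 0)%N).
  by rewrite size_map size_enum_ord size_to_ballot size_word.
move=> i; rewrite size_map size_enum_ord => ltir.
rewrite (nth_map (Ordinal ltir)) ?size_enum_ord // -surjective_pairing.
by rewrite /ballot_exp nth_enum_ord.
Qed.

Lemma ballot_exp_content mu x :
  ((ballot_exp mu x).1 + (ballot_exp mu x).2 = mu (lshift r x) + mu (rshift r x))%N.
Proof.
have sz : (x < size (to_ballot 0 0 (word mu)))%N by rewrite size_to_ballot size_word.
have sz' : (x < size (word mu))%N by rewrite size_word.
have := congr1 (fun t => nth 0%N t x) (to_ballot_content 0 0 (word mu)).
rewrite !(nth_map (0, 0)%N) // -/(ballot_exp mu x) nth_word => ->.
by case: ifP => _ //=; rewrite addnC.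
Qed.

(** The [-] are the s and the v, and deg s + deg v = deg s + deg u. That this number depends on [d]
    alone is what [to_ballot_inj] requires. *)
Lemma sumn_word d mu : balanced d mu -> sumn (unzip2 (word mu)) = d.
Proof.
case/balancedP => Euv _ <-; rewrite sumnE /unzip2 /word -map_comp big_map.
rewrite big_enum /= big_split_ord /=.
rewrite addnC Euv; congr (_ + _)%N; apply: eq_bigr => i _.
  by rewrite ltnNge leq_addr.
by rewrite ltn_ord.
Qed.

Lemma ballot_mnm_inj d : {in balanced d &, injective ballot_mnm}.
Proof.
move=> mu mu' Bmu Bmu' /mnmP Emu.
have Eexp : ballot_exp mu =1 ballot_exp mu'.
  move=> x; have := Emu (rshift r x); have := Emu (lshift r x).
  rewrite !mnmE (unsplitK (inl x)) (unsplitK (inr x)).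
  by case: (ballot_exp mu x) (ballot_exp mu' x) => [a b] [a' b'] /= -> ->.
have Et : to_ballot 0 0 (word mu) = to_ballot 0 0 (word mu').
  by rewrite -!map_ballot_exp; apply: eq_map => x; rewrite Eexp.
have Es : (0 + sumn (unzip2 (word mu)) = 0 + sumn (unzip2 (word mu')))%N.
  by rewrite (sumn_word Bmu) (sumn_word Bmu').
have [_ Ew] := to_ballot_inj (leqnn 0) (leqnn 0) Et Es.
have Ex x : (mu (lshift r x) = mu' (lshift r x)) * (mu (rshift r x) = mu' (rshift r x)).
  have := congr1 (fun t => nth (0, 0)%N t x) Ew.
  by rewrite !nth_word; case: ifP => _ [-> ->].
by apply/mnmP => k; case: (split_ordP k) => x ->; rewrite Ex.
Qed.

Lemma ballot_mnmE mu : ballot_mnm mu =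
  (\sum_(x <- enum 'I_r) (U_(lshift r x) *+ (ballot_exp mu x).1
                          + U_(rshift r x) *+ (ballot_exp mu x).2))%MM.
Proof.
apply/mnmP => k; rewrite mnmE mnm_sumE big_enum /=.
case: (split_ordP k) => x ->; rewrite (bigD1 x) //= big1 ?addn0 => [|y neyx];
  rewrite !(mnmDE, mulmnE, mnm1E) !(eq_lshift, eq_rshift, eq_lrshift, eq_rlshift);
  rewrite ?(negbTE neyx) //.
  by rewrite eqxx mul1n mul0n addn0.
by rewrite eqxx mul1n mul0n.
Qed.

Lemma sum_in_u (w : 'I_r -> nat) : (\sum_x w x * in_u x = \sum_i w (lshift n i))%N.
Proof.
rewrite big_split_ord /= [X in (_ + X)%N]big1 ?addn0 => [|j _].
  by apply: eq_bigr => i _; rewrite /in_u /= ltn_ord muln1.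
by rewrite /in_u /= ltnNge leq_addr muln0.
Qed.

Lemma sum_in_v (w : 'I_r -> nat) : (\sum_x w x * in_v x = \sum_j w (rshift m j))%N.
Proof.
rewrite big_split_ord /= [X in (X + _)%N]big1 ?add0n => [|j _].
  by apply: eq_bigr => i _; rewrite /in_v /= leq_addr muln1.
by rewrite /in_v /= leqNgt ltn_ord muln0.
Qed.

Lemma balanced_lead (F : fieldType) d mu : balanced d mu ->
  exists f : {mpoly F[L]}, [/\ in_jet_algebra d f, f != 0 & mlead f = ballot_mnm mu].
Proof.
move=> Bmu; have [|||s [t [lt_t lead_st cnt]]] := @ballot_bracket_prod F m n
  (fun x => (ballot_exp mu x).1) (fun x => (ballot_exp mu x).2) (enum 'I_r) [::].
- rewrite -(pairwise_map val ltn) val_enum_ord.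
  by rewrite -sorted_pairwise ?iota_ltn_sorted //; apply: ltn_trans.
- exact: allrel0l.
- by rewrite map_ballot_exp; apply: ballot_to_ballot.
exists (bracket_prod F s t); split; last first.
- by rewrite lead_st big_nil add0m ballot_mnmE.
- exact: bracket_prod_neq0.
have [Euv Esq Ed] := (balancedP d mu).1 Bmu.
(* Column sums survive [to_ballot], so the degrees in the two groups of columns are deg u + deg s
   and deg v + deg q, both equal to [d]. *)
apply: bracket_prod_in_jet_algebra => //; rewrite cnt big_nil add0n big_enum /=.
  rewrite sum_in_u -Ed -big_split /=; apply: eq_bigr => i _.
  exact: ballot_exp_content.
rewrite sum_in_v -Ed Euv Esq -big_split /=; apply: eq_bigr => j _.
exact: ballot_exp_content.
Qed.

(** * Enumeration of the balanced monomials *)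

Definition mnm_list k a : seq 'X_{1..k} := [seq s2m (tval t) | t <- enum (basis k a)].

Lemma mem_mnm_list k a (mu : 'X_{1..k}) : (mu \in mnm_list k a) = (mdeg mu == a).
Proof. by rewrite basis_cover. Qed.

Lemma uniq_mnm_list k a : uniq (mnm_list k a).
Proof. exact: uniq_basis. Qed.

Lemma size_mnm_list k a : size (mnm_list k.+1 a) = 'C(a + k, k).
Proof. by rewrite [size _]size_basis -bin_sub ?leq_addr // addKn. Qed.

Definition quadruples d a :=
  [seq (b, c) | b <- [seq (U, V) | U <- mnm_list m a, V <- mnm_list n a],
                c <- [seq (W, Q) | W <- mnm_list m (d - a), Q <- mnm_list n (d - a)]].

Lemma mem_quadruples d a c : c \in quadruples d a =
  [&& mdeg c.1.1 == a, mdeg c.1.2 == a,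
      mdeg c.2.1 == (d - a)%N & mdeg c.2.2 == (d - a)%N].
Proof.
case: c => [[U V] [W Q]] /=; rewrite -!mem_mnm_list.
apply/allpairsP/and4P => [[[b c] /= [/allpairsP[b' /= [HU HV Db]]]]|].
  case/allpairsP => c' /= [HS HQ Dc].
  by rewrite Db Dc => -[-> -> -> ->].
move=> [HU HV HS HQ]; exists (U, V, (W, Q)).
by split=> //; apply/allpairsP; [exists (U, V) | exists (W, Q)].
Qed.

Lemma uniq_quadruples d a : uniq (quadruples d a).
Proof.
by apply: allpairs_uniq; [apply: allpairs_uniq | apply: allpairs_uniq |];
  rewrite ?uniq_mnm_list //; apply: in2W => -[? ?] [? ?].
Qed.

Definition balanced_list d : seq 'X_{1..L} :=
  [seq join_mnm c | a <- iota 0 d.+1, c <- quadruples d a].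

Lemma mem_balanced_list d mu : mu \in balanced_list d -> balanced d mu.
Proof.
case/allpairsPdep => [a [c [Ha Hc ->]]]; rewrite /balanced join_mnmK.
move: Ha Hc; rewrite mem_iota add0n ltnS mem_quadruples /= => leda.
by move=> /and4P[/eqP -> /eqP -> /eqP -> /eqP ->]; rewrite !eqxx subnKC ?eqxx.
Qed.

Lemma balanced_in_list d mu : balanced d mu -> mu \in balanced_list d.
Proof.
rewrite /balanced => /and3P[/eqP Euv /eqP Esq /eqP Ed].
apply/allpairsPdep; exists (mdeg (split_mnm mu).1.1), (split_mnm mu).
rewrite mem_iota mem_quadruples split_mnmK -Euv -Esq -Ed addKn !eqxx.
by split; rewrite ?add0n ?ltnS ?leq_addr.
Qed.

Lemma uniq_balanced_list d : uniq (balanced_list d).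
Proof.
apply: allpairs_uniq_dep; first exact: iota_uniq.
  by move=> a _; apply: uniq_quadruples.

move=> _ _ /allpairsPdep[a [c [_ Hc ->]]] /allpairsPdep[a' [c' [_ Hc' ->]]] /=.
move/(can_inj join_mnmK) => Ec; move: Hc Hc'; rewrite !mem_quadruples Ec.
by move=> /and4P[/eqP <- _ _ _] /and4P[/eqP <- _ _ _].
Qed.

End BalancedMonomials.

(** For fixed a = deg u = deg v the (u, v) part and the (s, q) part are independent; this
    convolution is the source of the square in the Hilbert series. *)
Lemma size_balanced_list M N d : size (balanced_list M.+1 N.+1 d) =
  (\sum_(a < d.+1) 'C(a + M, M) * 'C(a + N, N) *
                   ('C(d - a + M, M) * 'C(d - a + N, N)))%N.
Proof.
rewrite size_allpairs_dep sumnE big_map -[iota _ _]/(index_iota 0 d.+1) big_mkord.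
by apply: eq_bigr => a _; rewrite !size_allpairs !size_mnm_list.
Qed.

(** The forms are preimages of bracket products, one for each balanced monomial; [ballot_mnm_inj]
    makes the leading monomials of their images distinct. *)
Lemma free_family (F : fieldType) m n d (k := size (balanced_list m n d)) :
  exists2 b : 'I_k -> {mpoly F[m * n + m * n]}, forall i, b i \is d.-homog &
    forall c : 'I_k -> F, tangent_map (\sum_(i < k) c i *: b i) = 0 ->
    forall i, c i = 0.
Proof.
pose E i := nth 0%MM (balanced_list m n d) i.
have BE (i : 'I_k) : balanced d (E i) by apply/mem_balanced_list/mem_nth.
have exb (i : 'I_k) : exists b : {mpoly F[m * n + m * n]}, [/\ b \is d.-homog,
    tangent_map b != 0 & mlead (tangent_map b) = ballot_mnm (E i)].
  by have [f [[b hb <-] f0 lf]] := balanced_lead F (BE i); exists b.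
have [b Hb] := fin_all_exists exb.
exists b => [i|c]; first by case: (Hb i).
rewrite raddf_sum /= => sum0.
apply: (@free_distinct_mlead F _ _ (fun i => tangent_map (b i)) _ _ c).
- by move=> i; case: (Hb i).
- move=> i j; have [[_ _ ->] [_ _ ->]] := (Hb i, Hb j).
  move/(ballot_mnm_inj (BE i) (BE j))/eqP; rewrite nth_uniq ?uniq_balanced_list //.
  by move/eqP/val_inj.
rewrite -{}[RHS]sum0; apply: eq_bigr => i _ /=.
by rewrite -!mul_mpolyC rmorphM /= /tangent_map mmapC.
Qed.

(** * Degeneration and the upper bound *)

(** Used with [A d] the forms of degree d, and with [A d] the polynomials whose support is balanced
    of degree d. *)
Lemma mmap_graded (F : fieldType) N M (A : nat -> {mpoly F[M]} -> Prop)
    (h : 'I_N -> {mpoly F[M]}) :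
  A 0%N 1 -> (forall d, A d 0) ->
  (forall d f g, A d f -> A d g -> A d (f + g)) ->
  (forall d c f, A d f -> A d (c *: f)) ->
  (forall d e f g, A d f -> A e g -> A (d + e)%N (f * g)) ->
  (forall k, A 1%N (h k)) ->
  forall d p, p \is d.-homog -> A d (mmap (@mpolyC M F) h p).
Proof.
move=> A1 A0 AD AZ AM Ah d p /dhomogP hp.
have AX k i : A i (h k ^+ i).
  by elim: i => [|i IHi] //; rewrite exprS -add1n; apply: AM.
 rewrite /mmap big_seq.
apply: (big_ind (A d)) => // [f g|mu /hp <-]; first exact: AD.
rewrite mul_mpolyC; apply: AZ; rewrite /= mdegE /mmap1.
elim/big_rec2: _ => // k f e _ Af; exact: AM (AX _ _) Af.
Qed.

Lemma mpoly_relation (F : fieldType) N k (f : 'I_k.+1 -> {mpoly F[N]})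
    (l : seq 'X_{1..N}) : (size l <= k)%N ->
  (forall i, {subset msupp (f i) <= l}) ->
  exists2 c : 'I_k.+1 -> F, exists i, c i != 0 & \sum_i c i *: f i = 0.
Proof.
move=> szl suppf; pose M := \matrix_(i < k.+1, j < size l) (f i)@_(nth 0%MM l j).
have : kermx M != 0.
  rewrite -mxrank_eq0 mxrank_ker -lt0n subn_gt0.
  by rewrite (leq_ltn_trans (rank_leq_col M)) // ltnS.
case/rowV0Pn=> c /sub_kermxP cM0 c0; exists (c ord0).
  apply/existsP; apply: contraNT c0 => /existsPn c0.
  by apply/eqP/rowP => i; have /negPn/eqP -> := c0 i; rewrite mxE.
apply/mpolyP => mu; rewrite mcoeff0 raddf_sum /=.
have [lmu|lmu] := boolP (mu \in l); last first.
  rewrite big1 // => i _; rewrite mcoeffZ memN_msupp_eq0 ?mulr0 //.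
  by apply: contra lmu => /suppf.
move: cM0 => /rowP; rewrite -index_mem in lmu => /(_ (Ordinal lmu)).
move=> E; transitivity ((c *m M) ord0 (Ordinal lmu)); last by rewrite E mxE.
rewrite mxE; apply: eq_bigr => i _.
by rewrite mcoeffZ !mxE nth_index // -index_mem.
Qed.

(** * Deformation to the product of two rank-one loci *)

Section Deformation.
Variables (F : closedFieldType) (m n : nat).
Local Notation L := ((m + n) + (m + n))%N.
Local Notation N := (m * n + m * n)%N.

(** The correction term makes u v^T plus [e] times the velocity equal to (u + e s)(v - e q)^T, again
    of rank at most 1: tangents are deformed into secants. *)
Definition deformed_jet (S : ringType) (e : S) (z : 'I_L -> S) : 'rV[S]_N :=
  row_mx (mxvec (\matrix_(i, j) (z (idx_u n i) * z (idx_v m j))))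
         (mxvec (\matrix_(i, j) (z (idx_s n i) * z (idx_v m j)
            - z (idx_u n i) * z (idx_q m j) - e * (z (idx_s n i) * z (idx_q m j))))).

Lemma deformed_jetX (S : ringType) (e : S) (z : 'I_L -> S) i j :
  deformed_jet e z ord0 (lshift (m * n) (mxvec_index i j)) =
  z (idx_u n i) * z (idx_v m j).
Proof. by rewrite row_mxEl mxvecE mxE. Qed.

Lemma deformed_jetY (S : ringType) (e : S) (z : 'I_L -> S) i j :
  deformed_jet e z ord0 (rshift (m * n) (mxvec_index i j)) =
  z (idx_s n i) * z (idx_v m j) - z (idx_u n i) * z (idx_q m j)
    - e * (z (idx_s n i) * z (idx_q m j)).
Proof. by rewrite row_mxEr mxvecE mxE. Qed.

Definition deformed_map (e : F) : {mpoly F[N]} -> {mpoly F[L]} :=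
  mmap (@mpolyC L F) (deformed_jet e%:MP (fun k => 'X_k) ord0).

Definition generic_map : {mpoly F[N]} -> {mpoly {poly F}[L]} :=
  mmap (@mpolyC L {poly F} \o polyC) (deformed_jet 'X%:MP (fun k => 'X_k) ord0).

Definition product_jet : 'rV[{mpoly F[L]}]_N :=
  row_mx (mxvec (\matrix_(i, j) ('X_(idx_u n i) * 'X_(idx_v m j))))
         (mxvec (\matrix_(i, j) ('X_(idx_s n i) * 'X_(idx_q m j)))).

Definition product_map : {mpoly F[N]} -> {mpoly F[L]} :=
  mmap (@mpolyC L F) (product_jet ord0).

(** The difference quotient (Y - X) / e recovers the velocity from two points of a secant. *)
Definition secant_jet (e : F) : 'rV[{mpoly F[N]}]_N :=
  row_mx (mxvec (genX F m n))
    (mxvec (\matrix_(i, j) (e^-1 *: (genY F m n i j - genX F m n i j)))).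

Definition secant_map (e : F) : {mpoly F[N]} -> {mpoly F[N]} :=
  mmap (@mpolyC N F) (secant_jet e ord0).

Definition shear (e : F) (k : 'I_L) : {mpoly F[L]} :=
  match split k with
  | inl _ => 'X_k
  | inr x => match split x with
             | inl i => 'X_(idx_u n i) + e *: 'X_(idx_s n i)
             | inr j => 'X_(idx_v m j) - e *: 'X_(idx_q m j)
             end
  end.

Definition shear_map (e : F) : {mpoly F[L]} -> {mpoly F[L]} :=
  mmap (@mpolyC L F) (shear e).

HB.instance Definition _ e := GRing.RMorphism.on (deformed_map e).
HB.instance Definition _ := GRing.RMorphism.on generic_map.
HB.instance Definition _ := GRing.RMorphism.on product_map.
HB.instance Definition _ e := GRing.RMorphism.on (secant_map e).
HB.instance Definition _ e := GRing.RMorphism.on (shear_map e).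

Lemma deformed_map0 p : deformed_map 0 p = tangent_map p.
Proof.
apply: mmap_congr => // k; elim/jet_index_ind: k => i j.
  by rewrite deformed_jetX tangent_jetX.
by rewrite deformed_jetY tangent_jetY mpolyC0 mul0r subr0.
Qed.

Lemma generic_map_horner e p :
  map_mpoly (horner_eval e) (generic_map p) = deformed_map e p.
Proof.
rewrite -[LHS]/((map_mpoly (horner_eval e) \o generic_map) p) rmorph_mpolyE.
apply: mmap_congr => [c|k] /=.
  by rewrite /generic_map mmapC /= map_mpolyC /= /horner_eval hornerC.
rewrite /generic_map mmapX mmap1U; elim/jet_index_ind: k => i j.
  by rewrite !deformed_jetX rmorphM /= !map_mpolyX.
rewrite !deformed_jetY !rmorphB !rmorphM /= !map_mpolyX map_mpolyC /=.
by rewrite /horner_eval hornerX.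
Qed.

Lemma deformed_map_secant e p : e != 0 ->
  deformed_map e p = shear_map e (product_map (secant_map e p)).
Proof.
move=> e0; rewrite -[RHS]/((shear_map e \o product_map \o secant_map e) p).
rewrite [RHS]rmorph_mpolyE; apply: mmap_congr => [c|k] /=.
  by rewrite /secant_map mmapC /product_map mmapC /shear_map mmapC.
have prodX i j : product_map (genX F m n i j) = 'X_(idx_u n i) * 'X_(idx_v m j).
  by rewrite mxE /product_map mmapX mmap1U row_mxEl mxvecE mxE.
have prodY i j : product_map (genY F m n i j) = 'X_(idx_s n i) * 'X_(idx_q m j).
  by rewrite mxE /product_map mmapX mmap1U row_mxEr mxvecE mxE.
have shE k' : shear_map e 'X_k' = shear e k' by rewrite /shear_map mmapX mmap1U.
have shu i : shear e (idx_u n i) = 'X_(idx_u n i) by rewrite /shear (unsplitK (inl _)).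
have shv j : shear e (idx_v m j) = 'X_(idx_v m j) by rewrite /shear (unsplitK (inl _)).
have shs i : shear e (idx_s n i) = 'X_(idx_u n i) + e *: 'X_(idx_s n i).
  by rewrite /shear (unsplitK (inr _)) (unsplitK (inl _)).
have shq j : shear e (idx_q m j) = 'X_(idx_v m j) - e *: 'X_(idx_q m j).
  by rewrite /shear !(unsplitK (inr _)).
rewrite {1}/secant_map mmapX mmap1U; elim/jet_index_ind: k => i j.
  by rewrite deformed_jetX row_mxEl mxvecE prodX rmorphM /= !shE shu shv.
rewrite deformed_jetY row_mxEr mxvecE mxE -mul_mpolyC.
have constE c : shear_map e (product_map c%:MP) = c%:MP.
  by rewrite /product_map mmapC /shear_map mmapC.
rewrite (rmorphM product_map) (rmorphM (shear_map e)) (rmorphB product_map).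
rewrite (rmorphB (shear_map e)) /= constE prodX prodY !(rmorphM (shear_map e)) /=.
rewrite !shE shu shv shs shq -!mul_mpolyC.
apply: (mulfI (x := e%:MP)); first by rewrite mpolyC_eq0.
rewrite [RHS]mulrA -mpolyCM mulfV // mpolyC1 mul1r.
by ring.
Qed.

End Deformation.

(** * Linear relations for nonzero parameter and their limit at zero *)

Section UpperBound.
Variables (F : closedFieldType) (m n : nat).
Local Notation L := ((m + n) + (m + n))%N.
Local Notation N := (m * n + m * n)%N.

Definition balanced_supp d (f : {mpoly F[L]}) : Prop :=
  {in msupp f, forall mu, balanced d mu}.

Lemma balancedD d e (mu nu : 'X_{1..L}) :
  balanced d mu -> balanced e nu -> balanced (d + e) (mu + nu)%MM.
Proof.
move=> /balancedP[Euv Esq Ed] /balancedP[Euv' Esq' Ee]; apply/balancedP.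
have sumD k (f : 'I_k -> 'I_L) :
    (\sum_i (mu + nu)%MM (f i) = \sum_i mu (f i) + \sum_i nu (f i))%N.
  by rewrite -big_split; apply: eq_bigr => i _; rewrite mnmDE.
by rewrite !sumD -Ed -Ee Euv Esq Euv' Esq'; split=> //; rewrite addnACA.
Qed.

Lemma balanced_uv i j : balanced 1 (U_(idx_u n i) + U_(idx_v m j))%MM.
Proof.
have -> : (U_(idx_u n i) + U_(idx_v m j) = join_mnm (U_(i), U_(j), (0, 0)))%MM.
  apply/mnmP => k; rewrite mnmDE [RHS]mnmE.
  case: (split_ordP k) => x ->; case: (split_ordP x) => y ->;
    rewrite !mnm1E !eq_shift ?(unsplitK (inl _)) ?(unsplitK (inr _))
      ?(unsplitK (inl _)) ?(unsplitK (inr _));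
    by rewrite ?mnm1E ?mnm0E ?addn0.
by rewrite /balanced join_mnmK /= !mdeg1 !mdeg0.
Qed.

Lemma balanced_sq i j : balanced 1 (U_(idx_s n i) + U_(idx_q m j))%MM.
Proof.
have -> : (U_(idx_s n i) + U_(idx_q m j) = join_mnm ((0, 0), (U_(i), U_(j))))%MM.
  apply/mnmP => k; rewrite mnmDE [RHS]mnmE.
  case: (split_ordP k) => x ->; case: (split_ordP x) => y ->;
    rewrite !mnm1E !eq_shift ?(unsplitK (inl _)) ?(unsplitK (inr _))
      ?(unsplitK (inl _)) ?(unsplitK (inr _));
    by rewrite ?mnm1E ?mnm0E ?addn0.
by rewrite /balanced join_mnmK /= !mdeg1 !mdeg0.
Qed.

Lemma product_map_balanced d p : p \is d.-homog -> balanced_supp d (product_map p).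
Proof.
apply: mmap_graded => {d p}.
- move=> mu; rewrite msupp1 inE => /eqP->.
  by apply/balancedP; rewrite !big1 // => i _; rewrite mnm0E.
- by move=> d mu; rewrite msupp0.
- by move=> d f g Bf Bg mu /msuppD_le; rewrite mem_cat => /orP[/Bf | /Bg].
- by move=> d c f Bf mu /msuppZ_le /Bf.
- move=> d e f g Bf Bg mu /msuppM_le /allpairsP[[a b] /= [/Bf Ba /Bg Bb ->]].
  exact: balancedD.
elim/jet_index_ind => i j.
  rewrite row_mxEl mxvecE mxE -mpolyXD => mu; rewrite msuppX inE => /eqP->.
  exact: balanced_uv.
rewrite row_mxEr mxvecE mxE -mpolyXD => mu; rewrite msuppX inE => /eqP->.
exact: balanced_sq.
Qed.

Lemma secant_map_homog e d p : p \is d.-homog -> @secant_map F m n e p \is d.-homog.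
Proof.
apply: (mmap_graded (A := fun d f => f \is d.-homog)) => {d p}.
- exact: dhomog1.
- by move=> d; apply: dhomog0.
- by move=> d f g; apply: rpredD.
- by move=> d c f; apply: rpredZ.
- by move=> d e' f g; apply: dhomogM.
elim/jet_index_ind => i j.
  by rewrite row_mxEl mxvecE mxE dhomogX /= mdeg1.
rewrite row_mxEr mxvecE mxE; apply: rpredZ.
by apply: rpredB; rewrite mxE dhomogX /= mdeg1.
Qed.

(** The relation is found after [product_map], where only balanced monomials occur, and is then
    pushed forward along [shear_map]. *)
Lemma deformed_relation e d (b : 'I_(size (balanced_list m n d)).+1 -> {mpoly F[N]}) :
  e != 0 -> (forall i, b i \is d.-homog) ->
  exists2 c : 'I_(size (balanced_list m n d)).+1 -> F, exists i, c i != 0 &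
    \sum_i c i *: deformed_map e (b i) = 0.
Proof.
move=> e0 hb.
have [|i mu /product_map_balanced|c nz_c rel_c] :=
  @mpoly_relation F _ _ (fun i => product_map (secant_map e (b i))) (balanced_list m n d).
- exact: leqnn.
- by move=> H; apply: balanced_in_list; apply: H; apply: secant_map_homog.
exists c => //; rewrite -[RHS](rmorph0 (shear_map e)) -[in RHS]rel_c rmorph_sum.
apply: eq_bigr => i _; rewrite deformed_map_secant // -!mul_mpolyC rmorphM /=.
by rewrite [in RHS]/shear_map mmapC.
Qed.

(** Semicontinuity of the rank: dependence for every nonzero parameter persists at 0. *)
Lemma tangent_relation d (b : 'I_(size (balanced_list m n d)).+1 -> {mpoly F[N]}) :
  (forall i, b i \is d.-homog) ->
  exists2 c : 'I_(size (balanced_list m n d)).+1 -> F, exists i, c i != 0 &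
    tangent_map (\sum_i c i *: b i) = 0.
Proof.
set k := (size _).+1 in b * => hb.
(* [B] bounds the degrees of the images at parameter 0, where the columns of [G] must catch every
   coefficient; at other values a relation is merely restricted to these columns. *)
pose B := \max_i msize (tangent_map (b i)).
pose nu (j : 'I_#|{: 'X_{1..L < B}}|) : 'X_{1..L} := bmnm (enum_val j).
pose G : 'M[{poly F}]_(k, #|{: 'X_{1..L < B}}|) :=
  \matrix_(i, j) (generic_map (b i))@_(nu j).
have GE e : map_mx (horner_eval e) G =
    \matrix_(i, j) (deformed_map e (b i))@_(nu j).
  by apply/matrixP => i j; rewrite !mxE -generic_map_horner mcoeff_map_mpoly.
have relation0 (c : 'rV_k) : c *m map_mx (horner_eval 0) G = 0 ->
    tangent_map (\sum_i c ord0 i *: b i) = 0.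
  move=> cG; rewrite raddf_sum; apply/mpolyP => mu; rewrite mcoeff0 raddf_sum /=.
  have coefE i : (tangent_map (c ord0 i *: b i))@_mu =
      c ord0 i * (tangent_map (b i))@_mu.
    by rewrite -mul_mpolyC rmorphM /= {1}/tangent_map mmapC mcoeffCM.
  have [ltB|leB] := ltnP (mdeg mu) B; last first.
    rewrite big1 // => i _; rewrite coefE [_@__]memN_msupp_eq0 ?mulr0 //.
    by apply: msize_mdeg_ge; apply: leq_trans leB; apply: leq_bigmax.
  move/rowP/(_ (enum_rank (BMultinom ltB))): cG; rewrite GE !mxE => E.
  rewrite -[RHS]E; apply: eq_bigr => i _.
  by rewrite mxE /nu enum_rankK deformed_map0 coefE.
have [freeG|] := boolP (row_free (map_mx (horner_eval 0) G)); last first.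
  rewrite -kermx_eq0 => /rowV0Pn[c /sub_kermxP cG c0]; exists (c ord0).
    apply/existsP; apply: contraNT c0 => /existsPn c0.
    by apply/eqP/rowP => i; have /negPn/eqP -> := c0 i; rewrite mxE.
  exact: relation0.
(* The minor picked out by the right inverse [H] is a polynomial in the
   deformation parameter; not vanishing at 0, it survives at some other value,
   where the images of the [b i] satisfy a linear relation. *)
have [H GH] := row_freeP freeG.
pose D := \det (G *m map_mx polyC H).
have DE e : D.[e] = \det (map_mx (horner_eval e) G *m H).
  rewrite -[LHS]/(horner_eval e D) /D -det_map_mx map_mxM -map_mx_comp.
  by congr (\det (_ *m _)); apply/matrixP => i j; rewrite mxE /= /horner_eval hornerC.
(* The factor ['X] keeps the chosen parameter away from 0. *)
have [e] : exists e, ~~ root (D * 'X) e.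
  apply/closed_nonrootP; rewrite mulf_neq0 ?polyX_eq0 //.
  apply: contraTneq (oner_neq0 F) => D0.
  by rewrite -(det1 F k) -GH -DE D0 horner0 eqxx.
rewrite rootM rootX negb_or => /andP[De e0].
have [c [i ci] rel_c] := deformed_relation e0 hb.
case/negP: ci; apply/eqP.
suff /rowP/(_ i) : \row_i c i = 0 by rewrite !mxE.
have unitGH : map_mx (horner_eval e) G *m H \in unitmx.
  by rewrite unitmxE unitfE -DE.
apply: (can_inj (mulmxK unitGH)); rewrite mul0mx mulmxA.
suff -> : \row_i c i *m map_mx (horner_eval e) G = 0 by rewrite mul0mx.
apply/rowP => j; rewrite GE !mxE.
have := congr1 (mcoeff (nu j)) rel_c; rewrite mcoeff0 raddf_sum /= => E.
by rewrite -[RHS]E; apply: eq_bigr => i' _; rewrite !mxE mcoeffZ.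
Qed.

End UpperBound.

(** * The Hilbert series as a count of balanced monomials *)

Theorem theorem4p11 (F : closedFieldType) (m n : nat)
    (hm : (2 < m)%N) (hmn : (m <= n)%N) :
  let num : {poly rat} :=
    \sum_(0 <= e < m) ('C(m.-1, e) * 'C(n.-1, e))%:R *: 'X^e in
  let den : {poly rat} := (1 - 'X) ^+ (m + n - 1) in
  let S : fps := fps_div (fps_poly num) (fps_poly den) in
  is_hilbert_series (@principal_ideal F m n) (fps_mul S S).
Proof.
have m0 : (0 < m)%N by apply: leq_trans hm.
have n0 : (0 < n)%N by apply: leq_trans hmn.
move=> num den S d; exists (size (balanced_list m n d)).
  apply: quot_dim_of_families; last exact: vanishing_ideal_is_ideal.
    have [b hb free_b] := free_family F m n d.
    by exists b => // c /(principal_idealP m0 n0); apply: free_b.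
  move=> b hb; have [c nz_c rel_c] := tangent_relation hb.
  by exists c => //; apply/(principal_idealP m0 n0).
(* With m = M + 1 and n = N + 1 the denominator has exponent M + N + 1, and the product of the two
   Segre series matches the count term by term. *)
case: m m0 hm hmn @num @den @S => // M _ _ _; case: n n0 => // N _ num den S.
rewrite size_balanced_list natr_sum; apply: eq_bigr => a _.
have SE : S =1 fun d => ('C(d + M, M) * 'C(d + N, N))%:R.
  move=> i; rewrite /S /num /den; have -> : (M.+1 + N.+1 - 1 = (M + N).+1)%N by lia.
  exact: coef_segre_series.
by rewrite !SE -natrM.
Qed.
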